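(* Let $\mathcal{D}=\left((\mathrm{E}_\alpha)_{\alpha\in I},(e_{\alpha,\beta})_{\alpha\preccurlyeq\beta}\right)$ be a direct system in $\mathbf{IVL}$, and let $\mathcal{S}=\left(\mathrm{E},(e_\alpha)_{\alpha\in I}\right)$ be the direct limit of $\mathcal{D}$ in $\mathbf{IVL}$. Let $\mathcal{D}^\sim=\left((\mathrm{E}_\alpha^\sim)_{\alpha\in I},(e_{\alpha,\beta}^\sim)_{\alpha\preccurlyeq\beta}\right)$ be the dual system. The following statements are true. (i) The inverse limit $\varprojlim\mathcal{D}^\sim=\left(\mathrm{F},(p_\alpha)_{\alpha\in I}\right)$ exists in $\mathbf{NVL}$. (ii) $(\varinjlim\mathcal{D})^\sim\cong\varprojlim\mathcal{D}^\sim$ in $\mathbf{NVL}$; that is, there exists a lattice isomorphism $T:\mathrm{E}^\sim\to\mathrm{F}$ such that $p_\alpha\circ T=e_\alpha^\sim$ for all $\alpha\in I$.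
   Context: All vector lattices are real. A linear map between vector lattices is a lattice homomorphism if it preserves finite suprema and infima; it is normal if it is moreover order continuous. A positive $T:\mathrm{E}\to\mathrm{F}$ is interval preserving if $T[[0,u]]=[0,T(u)]$ for all $0\le u\in\mathrm{E}$. The categories $\mathbf{NVL}$ and $\mathbf{IVL}$ have vector lattices as objects; morphisms are, respectively, normal lattice homomorphisms and interval preserving lattice homomorphisms. $\mathrm{E}^\sim$ is the vector lattice of order bounded linear functionals on $\mathrm{E}$; for a positive operator $T:\mathrm{E}\to\mathrm{F}$, $T^\sim:\mathrm{F}^\sim\to\mathrm{E}^\sim$ is $\varphi\mapsto\varphi\circ T$. Let $I$ be a directed set. A direct system in a category $\mathbf{C}$ consists of vector lattices $\mathrm{E}_\alpha$ and $\mathbf{C}$-morphisms $e_{\alpha,\beta}:\mathrm{E}_\alpha\to\mathrm{E}_\beta$ ($\alpha\preccurlyeq\beta$) with $e_{\beta,\gamma}\circ e_{\alpha,\beta}=e_{\alpha,\gamma}$ for $\alpha\preccurlyeq\beta\preccurlyeq\gamma$. A compatible system is a vector lattice $\mathrm{E}$ with $\mathbf{C}$-morphisms $e_\alpha:\mathrm{E}_\alpha\to\mathrm{E}$ such that $e_\beta\circ e_{\alpha,\beta}=e_\alpha$; the direct limit in $\mathbf{C}$ is a compatible system $(\mathrm{E},(e_\alpha))$ such that for every compatible system $(\tilde{\mathrm{E}},(\tilde e_\alpha))$ in $\mathbf{C}$ there is a unique $\mathbf{C}$-morphism $r:\mathrm{E}\to\tilde{\mathrm{E}}$ with $r\circ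 e_\alpha=\tilde e_\alpha$ for all $\alpha$. An inverse system in $\mathbf{C}$ consists of vector lattices $\mathrm{G}_\alpha$ and $\mathbf{C}$-morphisms $p_{\beta,\alpha}:\mathrm{G}_\beta\to\mathrm{G}_\alpha$ ($\beta\succcurlyeq\alpha$) with $p_{\beta,\alpha}\circ p_{\gamma,\beta}=p_{\gamma,\alpha}$ for $\alpha\preccurlyeq\beta\preccurlyeq\gamma$; compatible systems $(\mathrm{G},(p_\alpha:\mathrm{G}\to\mathrm{G}_\alpha))$ satisfy $p_{\beta,\alpha}\circ p_\beta=p_\alpha$, and the inverse limit in $\mathbf{C}$ is a compatible system such that for every compatible system $(\tilde{\mathrm{G}},(\tilde p_\alpha))$ in $\mathbf{C}$ there is a unique $\mathbf{C}$-morphism $s:\tilde{\mathrm{G}}\to\mathrm{G}$ with $p_\alpha\circ s=\tilde p_\alpha$ for all $\alpha$. The dual system $\mathcal{D}^\sim$, with maps $e_{\alpha,\beta}^\sim:\mathrm{E}_\beta^\sim\to\mathrm{E}_\alpha^\sim$, is an inverse system of normal interval preserving lattice homomorphisms. *)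

(* Defs.v *)
From HB Require Import structures.
From mathcomp Require Import all_boot all_order all_algebra.
From mathcomp Require Import all_classical reals ring lra.

Set Implicit Arguments.
Unset Strict Implicit.
Unset Printing Implicit Defensive.

Import Order.TTheory GRing.Theory Num.Theory.
Local Open Scope ring_scope.

(* The lattice operations are fields of the mixin: extending [Order.Lattice]
   would require joins that the algebraic hierarchy does not declare. *)
HB.mixin Record isVectorLattice (R : realType) E
    of GRing.Lmodule R E & Num.POrderedZmodule E := {
  vljoin : E -> E -> E;
  vlmeet : E -> E -> E;
  vl_leUx : forall x y z : E, (vljoin x y <= z) = (x <= z) && (y <= z);
  vl_lexI : forall x y z : E, (z <= vlmeet x y) = (z <= x) && (z <= y);
  vl_leD2r : forall z x y : E, x <= y -> x + z <= y + z;
  vl_scale_ge0 : forall (a : R) (x : E), 0 <= a -> 0 <= x -> 0 <= a *: x;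
}.

#[short(type="vectorLatticeType")]
HB.structure Definition VectorLattice (R : realType) :=
  { E of GRing.Lmodule R E & Num.POrderedZmodule E & isVectorLattice R E }.

Section VectorLatticeTheory.
Variables (R : realType) (E : vectorLatticeType R).
Implicit Types x y z u v : E.

Lemma vl_leDr z x y : (x + z <= y + z) = (x <= y).
Proof.
apply/idP/idP => [h|]; last exact: vl_leD2r.
by have := vl_leD2r (- z) _ _ h; rewrite !addrK.
Qed.

Lemma vl_leDl z x y : (z + x <= z + y) = (x <= y).
Proof. by rewrite ![z + _]addrC vl_leDr. Qed.

Lemma vl_leD x y u v : x <= y -> u <= v -> x + u <= y + v.
Proof. by move=> xy uv; apply: (@le_trans _ _ (y + u)); rewrite ?vl_leDr ?vl_leDl. Qed.

Lemma vl_addr_ge0 x y : 0 <= x -> 0 <= y -> 0 <= x + y.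
Proof. by move=> x0 y0; rewrite -[0]addr0 vl_leD. Qed.

Lemma vl_subr_ge0 x y : (0 <= x - y) = (y <= x).
Proof. by rewrite -(vl_leDr y 0) add0r subrK. Qed.

Lemma vl_leBl x y z : (x - y <= z) = (x <= z + y).
Proof. by rewrite -(vl_leDr y (x - y)) subrK. Qed.

Lemma vl_leN2 x y : (- x <= - y) = (y <= x).
Proof. by rewrite -[LHS]vl_subr_ge0 opprK addrC vl_subr_ge0. Qed.

Lemma vl_leNl x y : (- x <= y) = (- y <= x).
Proof. by rewrite -[LHS]vl_leN2 opprK. Qed.

Lemma vl_scale_le (a : R) x y : 0 <= a -> x <= y -> a *: x <= a *: y.
Proof.
move=> a0 xy; rewrite -vl_subr_ge0 -scalerBr vl_scale_ge0 //.
by rewrite vl_subr_ge0.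
Qed.

Lemma vl_leUl x y : x <= vljoin x y.
Proof. by have := lexx (vljoin x y); rewrite vl_leUx => /andP[]. Qed.

Lemma vl_leUr x y : y <= vljoin x y.
Proof. by have := lexx (vljoin x y); rewrite vl_leUx => /andP[]. Qed.

Lemma vl_leIl x y : vlmeet x y <= x.
Proof. by have := lexx (vlmeet x y); rewrite vl_lexI => /andP[]. Qed.

Lemma vl_leIr x y : vlmeet x y <= y.
Proof. by have := lexx (vlmeet x y); rewrite vl_lexI => /andP[]. Qed.

Lemma vl_join_l x y : y <= x -> vljoin x y = x.
Proof. by move=> yx; apply/le_anti; rewrite vl_leUl vl_leUx lexx yx. Qed.

Lemma vl_join_r x y : x <= y -> vljoin x y = y.
Proof. by move=> xy; apply/le_anti; rewrite vl_leUr vl_leUx lexx xy. Qed.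

Lemma vl_joinC x y : vljoin x y = vljoin y x.
Proof. by apply/le_anti; rewrite !vl_leUx !vl_leUl !vl_leUr. Qed.

Lemma vl_joinDr x y z : vljoin x y + z = vljoin (x + z) (y + z).
Proof.
apply/le_anti/andP; split; last by rewrite vl_leUx !vl_leDr vl_leUl vl_leUr.
by rewrite -[z in _ + z]opprK vl_leBl vl_leUx -!vl_leBl !opprK vl_leUl vl_leUr.
Qed.

Lemma vl_meetE x y : vlmeet x y = - vljoin (- x) (- y).
Proof.
apply/le_anti/andP; split; last first.
  by rewrite vl_lexI vl_leNl vl_leUl /= vl_leNl vl_leUr.
by rewrite -vl_leN2 opprK vl_leUx !vl_leN2 vl_leIl vl_leIr.
Qed.

Definition vlpos x : E := vljoin x 0.

Lemma vlpos_ge0 x : 0 <= vlpos x. Proof. exact: vl_leUr. Qed.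

Lemma vlposE x : vlpos x - vlpos (- x) = x.
Proof.
have -> : vlpos (- x) = vlpos x - x.
  by rewrite /vlpos vl_joinDr subrr add0r vl_joinC.
by rewrite opprB addrC subrK.
Qed.

Lemma vlpos_id x : 0 <= x -> vlpos x = x.
Proof. exact: vl_join_l. Qed.

Lemma vlposN_id x : 0 <= x -> vlpos (- x) = 0.
Proof. by move=> x0; apply: vl_join_r; rewrite -[0]oppr0 vl_leN2. Qed.

Lemma vl_joinE x y : vljoin x y = vlpos (x - y) + y.
Proof. by rewrite /vlpos vl_joinDr subrK add0r. Qed.

Lemma riesz_decomposition u v x : 0 <= u -> 0 <= v -> 0 <= x -> x <= u + v ->
  exists x1 x2, [/\ x = x1 + x2, 0 <= x1 <= u & 0 <= x2 <= v].
Proof.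
move=> u0 v0 x0 xuv; exists (vlmeet x u), (x - vlmeet x u); split.
- by rewrite addrC subrK.
- by rewrite vl_lexI x0 u0 vl_leIr.
rewrite vl_subr_ge0 vl_leIl /= vl_leBl addrC -vl_leBl vl_lexI !vl_leBl xuv.
by rewrite -[x in x <= _]addr0 vl_leDl v0.
Qed.

End VectorLatticeTheory.

Definition order_bounded d d' (T : porderType d) (T' : porderType d')
    (f : T -> T') : Prop :=
  forall a b, exists l u, (f @` `[a, b] `<=` `[l, u])%classic.

Section Operators.
Variable R : realType.
Implicit Types E F G : vectorLatticeType R.

Definition vlabs E (x : E) : E := vljoin x (- x).

Definition positive E F (f : E -> F) : Prop :=
  forall x : E, 0 <= x -> 0 <= f x.

Definition lattice_hom E F (f : E -> F) : Prop :=
  {morph f : x y / vljoin x y} /\ {morph f : x y / vlmeet x y}.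

Definition interval_preserving E F (f : E -> F) : Prop :=
  positive f /\
  forall u : E, 0 <= u -> (f @` `[0, u] = `[0, f u])%classic.

Definition lattice_iso E F (f : E -> F) : Prop := lattice_hom f /\ bijective f.

Lemma lattice_hom_positive E F (f : {linear E -> F}) :
  lattice_hom f -> positive f.
Proof.
by move=> [fU _] x x0; rewrite -(linear0 f) -(vl_join_l x0) fU vl_leUr.
Qed.

Lemma lattice_hom_pos E F (f : {linear E -> F}) :
  {morph f : x / vlpos x} -> lattice_hom f.
Proof.
move=> fpos.
have fU : {morph f : x y / vljoin x y}.
  by move=> x y; rewrite !vl_joinE linearD fpos linearB.
by split=> // x y; rewrite !vl_meetE linearN fU !linearN.
Qed.

End Operators.

Definition directed d (I : preorderType d) : Prop :=
  inhabited I /\ forall i j : I, exists k : I, (i <= k)%O && (j <= k)%O.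

Section OrderConvergence.
Variable R : realType.
Implicit Types E F : vectorLatticeType R.

Definition decreases_to0 d (I : preorderType d) E (y : I -> E) : Prop :=
  [/\ forall i j : I, (i <= j)%O -> y j <= y i,
      forall i, 0 <= y i
    & forall z : E, (forall i, z <= y i) -> z <= 0].

(* The dominating net [y] has the same index set as [x]. *)
Definition order_cvg d (I : preorderType d) E (x : I -> E) (l : E) : Prop :=
  exists2 y : I -> E, decreases_to0 y & forall i, vlabs (x i - l) <= y i.

Definition order_continuous E F (f : E -> F) : Prop :=
  forall d (I : preorderType d), directed I ->
  forall (x : I -> E) (l : E), order_cvg x l -> order_cvg (f \o x) (f l).

End OrderConvergence.

Section OrderDualLmodule.
Variables (R : realType) (E : vectorLatticeType R).

Definition order_dual_pred : {pred E -> R^o} :=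
  [pred f : E -> R^o | `[< scalar f /\ order_bounded (f : E -> R) >]].

Record order_dual := OrderDual {
  od_fun :> E -> R^o;
  od_funP : od_fun \in order_dual_pred }.

HB.instance Definition _ := [isSub for od_fun].
HB.instance Definition _ := [Choice of order_dual by <:].

Lemma order_dual_predP (f : E -> R^o) :
  reflect (scalar f /\ order_bounded (f : E -> R)) (f \in order_dual_pred).
Proof. exact: asboolP. Qed.

Lemma order_dual_submod : subsemimod_closed order_dual_pred.
Proof.
split; first split.
- apply/order_dual_predP; split.
    by move=> a x y; rewrite /= mulr0 addr0.
  by move=> a b; exists 0, 0 => _ [x _ <-] /=; rewrite in_itv /= !lexx.
- move=> f g /order_dual_predP[fL fB] /order_dual_predP[gL gB].
  apply/order_dual_predP; split.
    move=> a x y; rewrite -![(f + g) _]/(f _ + g _) fL gL.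
    by rewrite mulrDr addrACA.
  move=> a b; have [l [u lu]] := fB a b; have [l' [u' lu']] := gB a b.
  exists (l + l'), (u + u') => _ [x xab <-] /=; rewrite in_itv /=.
  have := lu (f x); rewrite /= in_itv /= => /(_ (ex_intro2 _ _ x xab erefl)).
  have := lu' (g x); rewrite /= in_itv /= => /(_ (ex_intro2 _ _ x xab erefl)).
  by move=> /andP[? ?] /andP[? ?]; rewrite !lerD.
- move=> k f /order_dual_predP[fL fB].
  apply/order_dual_predP; split.
    move=> a x y; rewrite -![(k *: f) _]/(k * f _ : R) fL.
    by rewrite mulrDr mulrCA.
  move=> a b; have [l [u lu]] := fB a b.
  have [k0|k0] := leP 0 k.
    exists (k * l), (k * u) => _ [x xab <-] /=; rewrite in_itv /=.
    have := lu (f x); rewrite /= in_itv /= => /(_ (ex_intro2 _ _ x xab erefl)).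
    by move=> /andP[? ?]; rewrite !ler_wpM2l.
  exists (k * u), (k * l) => _ [x xab <-] /=; rewrite in_itv /=.
  have := lu (f x); rewrite /= in_itv /= => /(_ (ex_intro2 _ _ x xab erefl)).
  by move=> /andP[? ?]; rewrite !ler_wnM2l // ltW.
Qed.

HB.instance Definition _ :=
  GRing.SubChoice_isSubLmodule.Build R (E -> R^o) order_dual_pred order_dual
    order_dual_submod.

Implicit Types phi psi : order_dual.

Lemma order_dualP phi psi : (forall x, phi x = psi x) -> phi = psi.
Proof. by move=> e; apply: val_inj; apply/funext. Qed.

Fact order_dual_scalar phi : scalar phi.
Proof. by case/order_dual_predP: (od_funP phi). Qed.

HB.instance Definition _ phi :=
  GRing.isLinear.Build R E R^o *%R phi (order_dual_scalar phi).

Lemma odD phi psi x : (phi + psi) x = phi x + psi x. Proof. by []. Qed.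
Lemma odN phi x : (- phi) x = - phi x. Proof. by []. Qed.
Lemma odZ a phi x : (a *: phi) x = a * phi x. Proof. by []. Qed.
Lemma od0 x : (0 : order_dual) x = 0. Proof. by []. Qed.

Definition od_le phi psi : bool :=
  `[< forall u : E, 0 <= u -> (phi u : R) <= psi u >].

Lemma od_eq_pos phi psi : (forall u, 0 <= u -> phi u = psi u) -> phi = psi.
Proof.
move=> e; apply: order_dualP => x; rewrite -(vlposE x) !linearB.
by congr (_ - _); apply: e; exact: vlpos_ge0.
Qed.

Fact od_le_refl : reflexive od_le.
Proof. by move=> phi; apply/asboolP => u. Qed.

Fact od_le_anti : antisymmetric od_le.
Proof.
move=> phi psi /andP[/asboolP h1 /asboolP h2]; apply: od_eq_pos => u u0.
by apply/le_anti; rewrite h1 ?h2.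
Qed.

Fact od_le_trans : transitive od_le.
Proof.
move=> psi phi chi /asboolP h1 /asboolP h2; apply/asboolP => u u0.
exact: le_trans (h1 u u0) (h2 u u0).
Qed.

HB.instance Definition _ := Order.Le_isPOrder.Build ring_display order_dual
  od_le_refl od_le_anti od_le_trans.

Lemma od_leP phi psi :
  reflect (forall u, 0 <= u -> (phi u : R) <= psi u) (phi <= psi).
Proof. exact: asboolP. Qed.

End OrderDualLmodule.

(* An additive, positively homogeneous, nonnegative function on the positive
   cone extends to a positive functional; it is used for the Riesz-Kantorovich
   formula [phi^+ u = sup (phi @` [0, u])] for [0 <= u]. *)

Section PositiveExtension.
Variables (R : realType) (E : vectorLatticeType R) (p : E -> R).
Hypothesis pD : forall u v, 0 <= u -> 0 <= v -> p (u + v) = p u + p v.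
Hypothesis pZ : forall a u, 0 <= a -> 0 <= u -> p (a *: u) = a * p u.
Hypothesis p_ge0 : forall u, 0 <= u -> 0 <= p u.

Let ext (x : E) : R^o := p (vlpos x) - p (vlpos (- x)).

Let extB a b : 0 <= a -> 0 <= b -> ext (a - b) = p a - p b.
Proof.
move=> a0 b0; rewrite /ext; set P := vlpos _; set N := vlpos _.
have h : P + b = a + N by rewrite -[P](subrK N) vlposE addrAC subrK.
apply/eqP; rewrite subr_eq addrAC eq_sym subr_eq.
by rewrite -!pD ?h ?vlpos_ge0.
Qed.

Fact ext_subproof : ext \in @order_dual_pred R E.
Proof.
have extL : scalar ext.
  move=> k x y.
  have P0 := @vlpos_ge0 R E.
  rewrite -{1}(vlposE x) -{1}(vlposE y) scalerBr addrACA -opprD.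
  have [k0|k0] := leP 0 k.
    rewrite extB ?vl_addr_ge0 ?vl_scale_ge0// !pD ?vl_scale_ge0// !pZ//.
    by rewrite /ext mulrBr addrACA -opprD.
  have nk0 : 0 <= - k by rewrite oppr_ge0 ltW.
  have -> : k *: vlpos x + vlpos y - (k *: vlpos (- x) + vlpos (- y)) =
     (- k *: vlpos (- x) + vlpos y) - (- k *: vlpos x + vlpos (- y)).
    by rewrite !scaleNr !opprD !opprK addrACA [RHS]addrACA [_ + - (k *: _)]addrC.
  rewrite extB ?vl_addr_ge0 ?vl_scale_ge0// !pD ?vl_scale_ge0// !pZ//.
  rewrite /ext; ring.
apply/order_dual_predP; split => // a b.
have p0 : p 0 = 0 by rewrite -(scale0r (0 : E)) pZ ?lexx// mul0r.
have ext_ge0 u : 0 <= u -> 0 <= (ext u : R).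
  by move=> u0; rewrite -[u]subr0 extB ?lexx // p0 subr0 p_ge0.
pose phi : {scalar E} := HB.pack_for {scalar E} ext
  (GRing.isLinear.Build R E R^o *%R ext extL).
have ext_le x y : x <= y -> (ext x : R) <= ext y.
  move=> xy; rewrite -subr_ge0 -[ext y]/(phi y) -[ext x]/(phi x) -linearB.
  by apply: ext_ge0; rewrite vl_subr_ge0.
exists (ext a), (ext b) => _ [x /= + <-]; rewrite !in_itv/= => /andP[ax xb].
by rewrite !ext_le.
Qed.

Definition extend : order_dual E := OrderDual ext_subproof.

Lemma extendE u : 0 <= u -> extend u = p u.
Proof.
move=> u0; rewrite -[u]subr0 -[LHS]/(ext _) extB ?lexx// -(scale0r (0 : E)) pZ ?lexx//.
by rewrite mul0r scale0r !subr0.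
Qed.

End PositiveExtension.

Section RieszKantorovich.
Variables (R : realType) (E : vectorLatticeType R) (phi : order_dual E).

Let rk (u : E) : R := sup (phi @` `[0, u])%classic.

Let rk_ub u x : 0 <= x -> x <= u -> (phi x : R) <= rk u.
Proof.
move=> x0 xu; apply: ub_le_sup; last first.
  by exists x => //=; rewrite in_itv/= x0.
have /order_dual_predP[_ /(_ 0 u)[l [c lc]]] := od_funP phi.
by exists c => t /lc /=; rewrite in_itv/= => /andP[].
Qed.

Let rk_le u (c : R) : 0 <= u ->
  (forall x, 0 <= x -> x <= u -> (phi x : R) <= c) -> rk u <= c.
Proof.
move=> u0 h; apply: ge_sup; first by exists (phi 0), 0; rewrite //= in_itv/= lexx.
by move=> _ [x /= + <-]; rewrite in_itv/= => /andP[? ?]; apply: h.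
Qed.

Let rk_ge0 u : 0 <= u -> 0 <= rk u.
Proof. by move=> u0; have := rk_ub (lexx 0) u0; rewrite linear0. Qed.

Let rkD u v : 0 <= u -> 0 <= v -> rk (u + v) = rk u + rk v.
Proof.
move=> u0 v0; apply/le_anti/andP; split.
  apply: rk_le; first exact: vl_addr_ge0.
  move=> x x0 /(riesz_decomposition u0 v0 x0).
  move=> [x1 [x2 [-> /andP[? ?] /andP[? ?]]]].
  by rewrite linearD lerD// rk_ub.
rewrite -lerBrDr; apply: rk_le => // x x0 xu.
rewrite lerBrDr addrC -lerBrDr; apply: rk_le => // y y0 yv.
rewrite lerBrDr -[_ + _]/(phi y + phi x) -linearD.
by apply: rk_ub; rewrite ?vl_addr_ge0// addrC vl_leD.
Qed.

Let rkZ a u : 0 <= a -> 0 <= u -> rk (a *: u) = a * rk u.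
Proof.
rewrite le_eqVlt => /predU1P[<- u0|a0 u0].
  rewrite scale0r mul0r; apply/le_anti; rewrite rk_ge0// andbT.
  apply: rk_le => // x x0 x0'.
  have -> : x = 0 by apply/le_anti; rewrite x0 x0'.
  by rewrite linear0.
have ia0 : 0 <= a^-1 by rewrite invr_ge0 ltW.
apply/le_anti/andP; split.
  apply: rk_le; first by rewrite vl_scale_ge0// ltW.
  move=> x x0 xu; rewrite mulrC -ler_pdivrMr// mulrC.
  rewrite -[_ * _]/(a^-1 * phi x) -linearZ.
  apply: rk_ub; rewrite ?vl_scale_ge0//=.
  by rewrite -[u]scale1r -(mulVf (lt0r_neq0 a0)) -scalerA vl_scale_le.
rewrite mulrC -ler_pdivlMr//; apply: rk_le => // x x0 xu.
rewrite ler_pdivlMr// mulrC -[_ * _]/(a * phi x) -linearZ.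
by apply: rk_ub; rewrite /= ?vl_scale_ge0 ?vl_scale_le// ltW.
Qed.

Definition od_pos : order_dual E := extend rkD rkZ rk_ge0.

Lemma od_pos_ub u x : 0 <= x -> x <= u -> (phi x : R) <= od_pos u.
Proof. by move=> x0 xu; rewrite extendE ?rk_ub// (le_trans x0). Qed.

Lemma od_pos_le u (c : R) : 0 <= u ->
  (forall x, 0 <= x -> x <= u -> (phi x : R) <= c) -> (od_pos u : R) <= c.
Proof. by move=> u0 h; rewrite extendE ?rk_le. Qed.

Lemma od_pos_ge0 u : 0 <= u -> 0 <= (od_pos u : R).
Proof. by move=> u0; rewrite extendE ?rk_ge0. Qed.

End RieszKantorovich.

Section OrderDualLattice.
Variables (R : realType) (E : vectorLatticeType R).
Implicit Types phi psi chi : order_dual E.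

Definition od_join phi psi := od_pos (phi - psi) + psi.
Definition od_meet phi psi := - od_join (- phi) (- psi).

Fact od_joinP phi psi chi :
  (od_join phi psi <= chi) = (phi <= chi) && (psi <= chi).
Proof.
apply/idP/andP => [/od_leP h|[/od_leP h1 /od_leP h2]].
  split; apply/od_leP => u u0; apply: le_trans (h u u0).
    have h' := od_pos_ub (phi - psi) u0 (lexx u).
    by rewrite -[od_join _ _ u]/(od_pos (phi - psi) u + psi u) -lerBlDr; exact: h'.
  by rewrite -[od_join _ _ u]/(od_pos _ u + psi u) lerDr od_pos_ge0.
apply/od_leP => u u0; rewrite -[od_join _ _ u]/(od_pos _ u + psi u) -lerBrDr.
apply: od_pos_le => // x x0 xu.
rewrite -[X in X <= _]/(phi x - psi x : R).
have := h1 x x0.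
have : (psi (u - x) : R) <= chi (u - x) by apply: h2; rewrite vl_subr_ge0.
rewrite !linearB /=.
move: (chi u : R) (psi u : R) (chi x : R) (psi x : R) (phi x : R) => a b c d e.
by move=> A B; lra.
Qed.

Fact od_leN2 phi psi : (- phi <= - psi) = (psi <= phi).
Proof.
by apply/od_leP/od_leP => h u /h; rewrite -!/(- _ u) lerN2.
Qed.

Fact od_meetP phi psi chi :
  (chi <= od_meet phi psi) = (chi <= phi) && (chi <= psi).
Proof. by rewrite -od_leN2 opprK od_joinP !od_leN2. Qed.

Fact od_leD2r chi phi psi : phi <= psi -> phi + chi <= psi + chi.
Proof.
move=> /od_leP h; apply/od_leP => u u0.
by rewrite -![(_ + chi) u]/(_ u + chi u) lerD2r h.
Qed.

Fact od_scale_ge0 (a : R) phi : 0 <= a -> 0 <= phi -> 0 <= a *: phi.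
Proof.
move=> a0 /od_leP h; apply/od_leP => u u0.
by rewrite -[X in _ <= X]/(a * phi u : R) mulr_ge0// h.
Qed.

HB.instance Definition _ := isVectorLattice.Build R (order_dual E)
  od_joinP od_meetP od_leD2r od_scale_ge0.

Lemma od_vlposE phi : vlpos phi = od_pos phi.
Proof. by rewrite -[LHS]/(od_pos (phi - 0) + 0) addr0 subr0. Qed.

End OrderDualLattice.

Section DualMap.
Variables (R : realType) (E F : vectorLatticeType R) (f : {linear E -> F}).
Hypothesis f_ge0 : positive f.

Fact dual_map_subproof (phi : order_dual F) :
  (phi \o f : E -> R^o) \in @order_dual_pred R E.
Proof.
apply/order_dual_predP; split; first by move=> a x y; rewrite /= !linearP.
move=> a b; have /order_dual_predP[_ /(_ (f a) (f b))[l [u lu]]] := od_funP phi.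
exists l, u => _ [x /= + <-]; rewrite in_itv/= => /andP[ax xb].
apply: lu; exists (f x) => //=; rewrite in_itv/=.
by rewrite -(vl_subr_ge0 (f x)) -(vl_subr_ge0 (f b)) -!linearB !f_ge0 ?vl_subr_ge0.
Qed.

Definition dual_fun (phi : order_dual F) : order_dual E :=
  OrderDual (dual_map_subproof phi).

Fact dual_fun_linear : linear dual_fun.
Proof. by move=> a phi psi; apply: order_dualP. Qed.

HB.instance Definition _ := GRing.isLinear.Build R (order_dual F) (order_dual E)
  *:%R dual_fun dual_fun_linear.

Definition dual_map : {linear order_dual F -> order_dual E} := dual_fun.

End DualMap.

Section Categories.
Variable R : realType.

Definition morphism_class := forall E F : vectorLatticeType R,
  {linear E -> F} -> Prop.

Definition NVL : morphism_class := fun E F f =>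
  lattice_hom f /\ order_continuous f.

Definition IVL : morphism_class := fun E F f =>
  lattice_hom f /\ interval_preserving f.

Lemma IVL_positive (E F : vectorLatticeType R) (f : {linear E -> F}) :
  IVL f -> positive f.
Proof. by case=> /lattice_hom_positive. Qed.

Lemma decreases_to0_dual d (I : preorderType d) (E : vectorLatticeType R)
    (y : I -> order_dual E) : directed I -> decreases_to0 y ->
  forall (v : E) (c : R), 0 <= v -> (forall i, c <= y i v) -> c <= 0.
Proof.
move=> [[i0] dirI] [y_decr y_ge0 y_inf].
pose p (v : E) : R := inf (range (fun i => y i v : R)).
have yge0 i v : 0 <= v -> 0 <= (y i v : R) by move=> v0; have /od_leP := y_ge0 i; exact.
have p_le i v : 0 <= v -> p v <= y i v.
  move=> v0; apply: ge_inf; last by exists i.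
  by exists 0 => _ [j _ <-]; exact: yge0.
have p_ge v c : (forall i, c <= y i v) -> c <= p v.
  by move=> h; apply: lb_le_inf; [exists (y i0 v), i0|move=> _ [j _ <-]].
have pD u v : 0 <= u -> 0 <= v -> p (u + v) = p u + p v.
  move=> u0 v0; apply/le_anti/andP; split; last first.
    by apply: p_ge => i; rewrite linearD lerD ?p_le.
  rewrite -lerBlDr; apply: (p_ge) => i; rewrite lerBlDr -lerBlDl.
  apply: (p_ge v (p (u + v) - y i u)) => j; rewrite lerBlDr; have [k /andP[ik jk]] := dirI i j.
  apply: (le_trans (p_le k _ (vl_addr_ge0 u0 v0))); rewrite linearD addrC.
  apply: lerD.
    by have /od_leP/(_ v v0) := y_decr _ _ jk.
  by have /od_leP/(_ u u0) := y_decr _ _ ik.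
have p_ge0 u : 0 <= u -> 0 <= p u by move=> u0; apply: p_ge => i; exact: yge0.
have pZ a u : 0 <= a -> 0 <= u -> p (a *: u) = a * p u.
  rewrite le_eqVlt => /predU1P[<- u0|a0 u0].
    rewrite scale0r mul0r; apply/le_anti; rewrite p_ge0 ?lexx// andbT.
    by have := p_le i0 _ (lexx (0 : E)); rewrite linear0.
  have au0 : 0 <= a *: u by rewrite vl_scale_ge0// ltW.
  apply/le_anti/andP; split.
    rewrite mulrC -ler_pdivrMr//; apply: p_ge => i; rewrite ler_pdivrMr// mulrC.
    by apply: (le_trans (p_le i _ au0)); rewrite linearZ.
  apply: p_ge => i; rewrite linearZ /= ler_wpM2l ?p_le// ltW//.
have P0 : extend pD pZ p_ge0 <= 0.
  by apply: y_inf => i; apply/od_leP => u u0; rewrite extendE// p_le.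
move=> v c v0 /p_ge /le_trans; apply.
by have /od_leP/(_ v v0) := P0; rewrite extendE.
Qed.

Lemma dual_map_NVL (E F : vectorLatticeType R) (f : {linear E -> F})
    (f_ge0 : positive f) :
  interval_preserving f -> NVL (dual_map f_ge0).
Proof.
move=> [_ f_int].
have fpos : {morph dual_map f_ge0 : phi / vlpos phi}.
  move=> phi; rewrite !od_vlposE; apply: od_eq_pos => u u0.
  apply/le_anti/andP; split.
    apply: od_pos_le; first exact: f_ge0.
    move=> y y0 yfu.
    have : (f @` `[0, u])%classic y by rewrite f_int//= in_itv/= y0.
    move=> [x /= + <-]; rewrite in_itv/= => /andP[x0 xu].
    exact: (od_pos_ub (dual_map f_ge0 phi)).
  apply: od_pos_le => // x x0 xu; apply: (@od_pos_ub _ _ phi (f u) (f x)); first exact: f_ge0.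
  by rewrite -vl_subr_ge0 -linearB f_ge0 ?vl_subr_ge0.
have flat := lattice_hom_pos fpos; split=> //.
have dual_le := lattice_hom_positive flat.
move=> d I dirI x l [y y0 xy]; exists (dual_map f_ge0 \o y); last first.
  move=> i; rewrite /vlabs /= -linearB -linearN -flat.1.
  by rewrite -vl_subr_ge0 -linearB dual_le ?vl_subr_ge0 ?xy.
have [y_decr y_ge0 y_inf] := y0; split=> [i j ij|i|z zy].
- by rewrite -vl_subr_ge0 -linearB dual_le ?vl_subr_ge0 ?y_decr.
- exact: dual_le.
apply/od_leP => u u0; apply: (decreases_to0_dual dirI y0 (f_ge0 _ u0)) => i.
by have /od_leP/(_ u u0) := zy i.
Qed.

End Categories.

Section Systems.
Variables (R : realType) (C : morphism_class R).
Variables (d : Order.disp_t) (I : preorderType d).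

(* [ds_map] at [a <= a] is not required to be the identity, only idempotent
   (by [ds_comp]); likewise for inverse systems. *)
Record direct_system := DirectSystem {
  ds_obj :> I -> vectorLatticeType R;
  ds_map : forall a b : I, (a <= b)%O -> {linear ds_obj a -> ds_obj b};
  ds_mapC : forall (a b : I) (ab : (a <= b)%O), C (ds_map ab);
  ds_comp : forall (a b c : I) (ab : (a <= b)%O) (bc : (b <= c)%O)
    (ac : (a <= c)%O), ds_map bc \o ds_map ab =1 ds_map ac }.

Record direct_compatible (D : direct_system) := DirectCompatible {
  dc_obj :> vectorLatticeType R;
  dc_map : forall a : I, {linear D a -> dc_obj};
  dc_mapC : forall a : I, C (dc_map a);
  dc_comp : forall (a b : I) (ab : (a <= b)%O),
    dc_map b \o ds_map D ab =1 dc_map a }.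

Definition is_direct_limit (D : direct_system) (S : direct_compatible D) :=
  forall S' : direct_compatible D,
  exists2 r : {linear S -> S'},
    C r /\ (forall a : I, r \o dc_map S a =1 dc_map S' a)
  & forall r' : {linear S -> S'},
    C r' -> (forall a : I, r' \o dc_map S a =1 dc_map S' a) -> r' =1 r.

Record inverse_system := InverseSystem {
  is_obj :> I -> vectorLatticeType R;
  is_map : forall a b : I, (a <= b)%O -> {linear is_obj b -> is_obj a};
  is_mapC : forall (a b : I) (ab : (a <= b)%O), C (is_map ab);
  is_comp : forall (a b c : I) (ab : (a <= b)%O) (bc : (b <= c)%O)
    (ac : (a <= c)%O), is_map ab \o is_map bc =1 is_map ac }.

Record inverse_compatible (G : inverse_system) := InverseCompatible {
  ic_obj :> vectorLatticeType R;
  ic_map : forall a : I, {linear ic_obj -> G a};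
  ic_mapC : forall a : I, C (ic_map a);
  ic_comp : forall (a b : I) (ab : (a <= b)%O),
    is_map G ab \o ic_map b =1 ic_map a }.

Definition is_inverse_limit (G : inverse_system) (S : inverse_compatible G) :=
  forall S' : inverse_compatible G,
  exists2 s : {linear S' -> S},
    C s /\ (forall a : I, ic_map S a \o s =1 ic_map S' a)
  & forall s' : {linear S' -> S},
    C s' -> (forall a : I, ic_map S a \o s' =1 ic_map S' a) -> s' =1 s.

End Systems.

Section DualSystem.
Variables (R : realType) (d : Order.disp_t) (I : preorderType d).
Variable D : direct_system (@IVL R) I.

Let dual_sys_map (a b : I) (ab : (a <= b)%O) :
    {linear order_dual (D b) -> order_dual (D a)} :=
  dual_map (IVL_positive (ds_mapC D ab)).

Fact dual_sys_mapC (a b : I) (ab : (a <= b)%O) : NVL (dual_sys_map ab).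
Proof. exact: dual_map_NVL (ds_mapC D ab).2. Qed.

Fact dual_sys_comp (a b c : I) (ab : (a <= b)%O) (bc : (b <= c)%O)
    (ac : (a <= c)%O) :
  dual_sys_map ab \o dual_sys_map bc =1 dual_sys_map ac.
Proof.
move=> phi; apply: order_dualP => x; rewrite /= -(ds_comp ab bc ac).
by [].
Qed.

Definition dual_system : inverse_system (@NVL R) I :=
  @InverseSystem R (@NVL R) d I (fun a => order_dual (D a)) dual_sys_map
    dual_sys_mapC dual_sys_comp.

End DualSystem.

(* Main.v *)
(** The order dual of [S], with the maps [phi |-> phi \o e_a], is itself an
    inverse limit: a compatible family of functionals [p_a phi] on the [D a]
    glues to the functional [e_a x |-> p_a phi x] on [S]. This needs every
    element of [S] to be some [e_a x], and [e_a x = 0] to force [x] to vanish at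
    a later stage of the system. Both facts hold for the concrete limit, the
    disjoint union of the [D a] modulo eventual equality, and pass to [S] by
    the universal property. The second statement is then the uniqueness of
    inverse limits. *)

Require Import Defs.
From HB Require Import structures.
From mathcomp Require Import all_boot all_order all_algebra.
From mathcomp Require Import all_classical reals.

Set Implicit Arguments.
Unset Strict Implicit.
Unset Printing Implicit Defensive.

Import Order.TTheory GRing.Theory Num.Theory.
Local Open Scope ring_scope.
Local Open Scope quotient_scope.

(** * Interval preserving and order continuous lattice homomorphisms *)

Section VectorLatticeMaps.
Variable R : realType.
Implicit Types E F G : vectorLatticeType R.

Lemma vl_le_join E (x y : E) : (x <= y) = (vljoin x y == y).
Proof.
by apply/idP/eqP => [/vl_join_r //|<-]; exact: vl_leUl.
Qed.

Lemma positive_le E F (f : {linear E -> F}) : positive f ->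
  {homo f : x y / x <= y}.
Proof.
by move=> f0 x y xy; rewrite -vl_subr_ge0 -linearB f0 ?vl_subr_ge0.
Qed.

Lemma lattice_hom_vlpos E F (f : {linear E -> F}) :
  lattice_hom f -> {morph f : x / vlpos x}.
Proof. by move=> [fU _] x; rewrite /vlpos fU linear0. Qed.

(** Positivity already gives that [f] maps [[0, u]] into [[0, f u]], so only the lifting of elements
    of [[0, f u]] remains to be supplied. *)
Lemma interval_preservingP E F (f : {linear E -> F}) : positive f ->
  (forall u w, 0 <= u -> 0 <= w -> w <= f u -> exists2 x, 0 <= x <= u & f x = w) ->
  interval_preserving f.
Proof.
move=> f0 fI; split=> // u u0; apply/seteqP; split=> [_ [x /= + <-]|w /=].
  by rewrite !in_itv /= => /andP[x0 xu]; rewrite f0 // (positive_le f0 xu).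
rewrite in_itv /= => /andP[w0 wfu]; have [x xu <-] := fI _ _ u0 w0 wfu.
by exists x; rewrite //= in_itv.
Qed.

Lemma interval_preserving_lift E F (f : E -> F) u w : interval_preserving f ->
  0 <= u -> 0 <= w -> w <= f u -> exists2 x, 0 <= x <= u & f x = w.
Proof.
move=> [_ fI] u0 w0 wu; have : (f @` `[0, u])%classic w.
  by rewrite fI //= in_itv /= w0.
by move=> [x /= + <-]; rewrite in_itv /= => xu; exists x.
Qed.

Lemma lattice_hom_comp E F G (f : F -> G) (g : E -> F) :
  lattice_hom f -> lattice_hom g -> lattice_hom (f \o g).
Proof.
by move=> [fU fI] [gU gI]; split=> x y /=; rewrite ?gU ?gI ?fU ?fI.
Qed.

Lemma IVL_id E : @IVL R E E idfun.
Proof.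
split=> //; apply: interval_preservingP => // u w u0 w0 wu.
by exists w; rewrite // w0.
Qed.

Lemma IVL_comp E F G (f : {linear F -> G}) (g : {linear E -> F}) :
  IVL f -> IVL g -> IVL (f \o g).
Proof.
move=> [fh fi] [gh gi]; split; first exact: lattice_hom_comp.
apply: interval_preservingP => [x x0|u w u0 w0 wu].
  by apply: fi.1; apply: gi.1.
have [y /andP[y0 yu] <-] := interval_preserving_lift fi (gi.1 _ u0) w0 wu.
have [x xu <-] := interval_preserving_lift gi u0 y0 yu.
by exists x.
Qed.

Lemma NVL_id E : @NVL R E E idfun.
Proof. by split=> // d I _ x l. Qed.

Lemma NVL_comp E F G (f : {linear F -> G}) (g : {linear E -> F}) :
  NVL f -> NVL g -> NVL (f \o g).
Proof.
move=> [fh fo] [gh go]; split; first exact: lattice_hom_comp.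
by move=> d I dirI x l /(go _ _ dirI) /(fo _ _ dirI).
Qed.

(** A net [y] decreasing to 0 dominates itself, so it order converges to 0. If [w] dominates the
    image net, then [f (y i) <= w i], and a lower bound of [f \o y] is also one of [w]. *)
Lemma order_continuous_decreases_to0 E F (f : {linear E -> F}) d
    (I : preorderType d) (y : I -> E) : lattice_hom f ->
  order_continuous f -> directed I -> decreases_to0 y -> decreases_to0 (f \o y).
Proof.
move=> fh fo dirI yd; have [y_decr y_ge0 _] := yd.
have f_ge0 := lattice_hom_positive fh.
have : order_cvg y 0.
  exists y => // i; rewrite subr0 /vlabs vl_leUx lexx /= vl_leNl.
  by rewrite (le_trans _ (y_ge0 i)) // vl_leNl oppr0.
move=> /(fo _ _ dirI)[w [_ _ w_inf] fw]; split=> [i j ij|i|z zy] /=.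
- by apply: positive_le => //; apply: y_decr.
- exact: f_ge0.
- apply: w_inf => i; apply: le_trans (zy i) (le_trans _ (fw i)).
  by rewrite linear0 subr0 vl_leUl.
Qed.

(** A lattice homomorphism commutes with the absolute value, so [f \o y] dominates the image of any
    net dominated by [y]. *)
Lemma order_continuousP E F (f : {linear E -> F}) : lattice_hom f ->
  (forall d (I : preorderType d) (y : I -> E), directed I ->
    decreases_to0 y -> decreases_to0 (f \o y)) ->
  order_continuous f.
Proof.
move=> fh fd d I dirI x l [y y0 xy]; exists (f \o y); first exact: fd.
move=> i; rewrite /vlabs /= -linearB -linearN -fh.1.
by apply: positive_le; [exact: lattice_hom_positive|exact: xy].
Qed.

End VectorLatticeMaps.

(** * The concrete direct limit: the disjoint union of the stages modulo eventual equality *)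

Section ConcreteDirectLimit.
Variables (R : realType) (d : Order.disp_t) (I : preorderType d).
Variables (dirI : directed I) (D : direct_system (@IVL R) I).

Lemma directed2 (a b : I) : exists c, (a <= c)%O /\ (b <= c)%O.
Proof. by have [c /andP[]] := dirI.2 a b; exists c. Qed.

Lemma ds_mapU a b (ab : (a <= b)%O) :
  {morph ds_map D ab : x y / vljoin x y}.
Proof. exact: (ds_mapC D ab).1.1. Qed.

Lemma ds_mapI a b (ab : (a <= b)%O) :
  {morph ds_map D ab : x y / vlmeet x y}.
Proof. exact: (ds_mapC D ab).1.2. Qed.

Definition ev_eq (p q : {a : I & D a}) : bool :=
  `[< exists c (pc : (tag p <= c)%O) (qc : (tag q <= c)%O),
        ds_map D pc (tagged p) = ds_map D qc (tagged q) >].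

Fact ev_eq_refl : reflexive ev_eq.
Proof. by move=> p; apply/asboolP; exists (tag p), (lexx _), (lexx _). Qed.

Fact ev_eq_sym : symmetric ev_eq.
Proof.
by move=> p q; apply/asboolP/asboolP => -[c [pc [qc e]]]; exists c, qc, pc.
Qed.

Fact ev_eq_trans : transitive ev_eq.
Proof.
move=> q p r /asboolP[b [pb [qb e]]] /asboolP[c [qc [rc e']]]; apply/asboolP.
have [k [bk ck]] := directed2 b c.
exists k, (le_trans pb bk), (le_trans rc ck).
(* At stage [k] both sides become the image of the middle element [q], along two factorizations of
   the same transition map. *)
rewrite -(ds_comp pb bk) -(ds_comp rc ck) /= e -e'.
rewrite -[LHS]/((_ \o _) _) -[RHS]/((_ \o _) _).
by rewrite !(ds_comp _ _ (le_trans qb bk)).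
Qed.

Canonical ev_eq_equiv := EquivRel ev_eq ev_eq_refl ev_eq_sym ev_eq_trans.

Definition dlim := {eq_quot ev_eq_equiv}.

HB.instance Definition _ := Choice.on dlim.

Implicit Types u v w : dlim.

Definition dlim_in a (x : D a) : dlim := \pi_dlim (Tagged (fun b : I => D b) x).

Lemma dlim_inP a b (x : D a) (y : D b) :
  dlim_in x = dlim_in y <->
  exists c (ac : (a <= c)%O) (bc : (b <= c)%O), ds_map D ac x = ds_map D bc y.
Proof.
split=> [/eqmodP /asboolP //|h].
by apply/eqmodP/asboolP.
Qed.

(** Stage [b] itself witnesses the equality: the map at [b <= b] is not assumed to be the identity,
    but it fixes the image of the map at [a <= b]. *)
Lemma dlim_in_map a b (ab : (a <= b)%O) (x : D a) :
  dlim_in (ds_map D ab x) = dlim_in x.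
Proof.
apply/dlim_inP; exists b, (lexx b), ab.
exact: (ds_comp ab (lexx b) ab x).
Qed.

Lemma dlim_in_eq a (x y : D a) :
  dlim_in x = dlim_in y <-> exists b (ab : (a <= b)%O), ds_map D ab x = ds_map D ab y.
Proof.
rewrite dlim_inP; split=> [[c [ac [ac']]]|[b [ab e]]]; last by exists b, ab, ab.
by rewrite (bool_irrelevance ac' ac); exists c, ac.
Qed.

Lemma dlim_rep u : exists a (x : D a), u = dlim_in x.
Proof.
by exists (tag (repr u)), (tagged (repr u)); rewrite /dlim_in taggedK reprK.
Qed.

Lemma dlim_rep2 u v : exists a (x y : D a), u = dlim_in x /\ v = dlim_in y.
Proof.
have [a [x ->]] := dlim_rep u; have [b [y ->]] := dlim_rep v.
have [c [ac bc]] := directed2 a b.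
by exists c, (ds_map D ac x), (ds_map D bc y); rewrite !dlim_in_map.
Qed.

Lemma dlim_rep3 u v w :
  exists a (x y z : D a), [/\ u = dlim_in x, v = dlim_in y & w = dlim_in z].
Proof.
have [a [x [y [-> ->]]]] := dlim_rep2 u v; have [b [z ->]] := dlim_rep w.
have [c [ac bc]] := directed2 a b.
by exists c, (ds_map D ac x), (ds_map D ac y), (ds_map D bc z);
  rewrite !dlim_in_map.
Qed.

Section Lift.
Variable op : forall a, D a -> D a -> D a.
Hypothesis opM : forall a b (ab : (a <= b)%O),
  {morph ds_map D ab : x y / op x y}.

Fact dlim_lift_subproof u v : exists w, exists a (x y : D a),
  [/\ u = dlim_in x, v = dlim_in y & w = dlim_in (op x y)].
Proof.
have [a [x [y [-> ->]]]] := dlim_rep2 u v.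
by exists (dlim_in (op x y)), a, x, y.
Qed.

(** Representatives of [u] and [v] at a common stage are picked by choice; [dlim_liftE] shows that
    the result does not depend on them. *)
Definition dlim_lift u v : dlim := projT1 (cid (dlim_lift_subproof u v)).

Lemma dlim_liftE a (x y : D a) :
  dlim_lift (dlim_in x) (dlim_in y) = dlim_in (op x y).
Proof.
rewrite /dlim_lift; case: cid => w /= [b [x' [y' [ex ey ->]]]].
have [c [ac bc]] := directed2 a b.
rewrite -(dlim_in_map ac) -(dlim_in_map bc) !opM.
move: ex ey; rewrite -(dlim_in_map ac x) -(dlim_in_map bc x').
rewrite -(dlim_in_map ac y) -(dlim_in_map bc y').
move=> /dlim_in_eq[k [ck ek]] /dlim_in_eq[k' [ck' ek']].
(* The first arguments agree from stage [k] on and the second ones from [k'] on, so both pairs agree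
   at [m], where [op] can be compared. *)
have [m [km km']] := directed2 k k'.
apply/dlim_in_eq; exists m, (le_trans ck km).
rewrite !opM; congr op.
  by rewrite -!(ds_comp ck km) /= ek.
by rewrite -!(ds_comp ck' km') /= ek'.
Qed.

End Lift.

Definition dlim_zero : dlim := dlim_in (0 : D (inhabited_witness dirI.1)).

Lemma dlim_zeroE a : dlim_zero = dlim_in (0 : D a).
Proof.
have [c [ic ac]] := directed2 (inhabited_witness dirI.1) a.
by apply/dlim_inP; exists c, ic, ac; rewrite !linear0.
Qed.

Fact dlim_addM a b (ab : (a <= b)%O) : {morph ds_map D ab : x y / x + y}.
Proof. exact: linearD. Qed.

Fact dlim_oppM a b (ab : (a <= b)%O) :
  {morph ds_map D ab : x y / (fun x _ => - x) x y}.
Proof. by move=> x _ /=; exact: linearN. Qed.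

Fact dlim_scaleM k a b (ab : (a <= b)%O) :
  {morph ds_map D ab : x y / (fun x _ => k *: x) x y}.
Proof. by move=> x _ /=; exact: linearZ. Qed.

(* Unary operations are lifted as binary ones that ignore their second
   argument. *)
Definition dlim_add := dlim_lift (fun a (x y : D a) => x + y).
Definition dlim_opp u := dlim_lift (fun a (x _ : D a) => - x) u u.
Definition dlim_scale k u := dlim_lift (fun a (x _ : D a) => k *: x) u u.
Definition dlim_join := dlim_lift (fun a (x y : D a) => vljoin x y).
Definition dlim_meet := dlim_lift (fun a (x y : D a) => vlmeet x y).
(** Defining the order through the join reduces it to an equality of classes; [dlim_leE] recovers
    the order of the stages. *)
Definition dlim_le u v : bool := dlim_join u v == v.

Lemma dlim_addE a (x y : D a) :
  dlim_add (dlim_in x) (dlim_in y) = dlim_in (x + y).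
Proof. exact: (dlim_liftE dlim_addM). Qed.

Fact dlim_oppE a (x : D a) : dlim_opp (dlim_in x) = dlim_in (- x).
Proof. exact: (dlim_liftE dlim_oppM). Qed.

Fact dlim_scaleE k a (x : D a) : dlim_scale k (dlim_in x) = dlim_in (k *: x).
Proof. exact: (dlim_liftE (dlim_scaleM k)). Qed.

Fact dlim_joinE a (x y : D a) :
  dlim_join (dlim_in x) (dlim_in y) = dlim_in (vljoin x y).
Proof. exact: (dlim_liftE ds_mapU). Qed.

Fact dlim_meetE a (x y : D a) :
  dlim_meet (dlim_in x) (dlim_in y) = dlim_in (vlmeet x y).
Proof. exact: (dlim_liftE ds_mapI). Qed.

Fact dlim_addA : associative dlim_add.
Proof.
move=> u v w; have [a [x [y [z [-> -> ->]]]]] := dlim_rep3 u v w.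
by rewrite !dlim_addE addrA.
Qed.

Fact dlim_addC : commutative dlim_add.
Proof.
move=> u v; have [a [x [y [-> ->]]]] := dlim_rep2 u v.
by rewrite !dlim_addE addrC.
Qed.

Fact dlim_add0 : left_id dlim_zero dlim_add.
Proof.
move=> u; have [a [x ->]] := dlim_rep u.
by rewrite (dlim_zeroE a) dlim_addE add0r.
Qed.

Fact dlim_addN : left_inverse dlim_zero dlim_opp dlim_add.
Proof.
move=> u; have [a [x ->]] := dlim_rep u.
by rewrite (dlim_zeroE a) dlim_oppE dlim_addE addNr.
Qed.

HB.instance Definition _ :=
  GRing.isZmodule.Build dlim dlim_addA dlim_addC dlim_add0 dlim_addN.

Lemma dlim_inD a (x y : D a) : dlim_in x + dlim_in y = dlim_in (x + y).
Proof. exact: dlim_addE. Qed.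

Lemma dlim_in0 a : dlim_in (0 : D a) = 0.
Proof. by rewrite -dlim_zeroE. Qed.

Fact dlim_scaleA k l u : dlim_scale k (dlim_scale l u) = dlim_scale (k * l) u.
Proof. by have [a [x ->]] := dlim_rep u; rewrite !dlim_scaleE scalerA. Qed.

Fact dlim_scale1 : left_id 1 dlim_scale.
Proof.
by move=> u; have [a [x ->]] := dlim_rep u; rewrite !dlim_scaleE scale1r.
Qed.

Fact dlim_scaleDr : right_distributive dlim_scale +%R.
Proof.
move=> k u v; have [a [x [y [-> ->]]]] := dlim_rep2 u v.
by rewrite dlim_inD !dlim_scaleE dlim_inD scalerDr.
Qed.

Fact dlim_scaleDl u : {morph dlim_scale^~ u : k l / k + l}.
Proof.
by move=> k l; have [a [x ->]] := dlim_rep u;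
  rewrite !dlim_scaleE dlim_inD scalerDl.
Qed.

HB.instance Definition _ := GRing.Zmodule_isLmodule.Build R dlim
  dlim_scaleA dlim_scale1 dlim_scaleDr dlim_scaleDl.

Lemma dlim_inZ k a (x : D a) : k *: dlim_in x = dlim_in (k *: x).
Proof. exact: dlim_scaleE. Qed.

(** The equality of classes [x \/ y = y] is reached at some stage, and the transition maps preserve
    joins. *)
Fact dlim_leE a (x y : D a) :
  dlim_le (dlim_in x) (dlim_in y) <->
  exists b (ab : (a <= b)%O), ds_map D ab x <= ds_map D ab y.
Proof.
rewrite /dlim_le dlim_joinE; split.
  move=> /eqP /dlim_in_eq[b [ab e]]; exists b, ab.
  by rewrite vl_le_join -ds_mapU e.
move=> [b [ab]]; rewrite vl_le_join -ds_mapU => /eqP e.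
by apply/eqP/dlim_in_eq; exists b, ab.
Qed.

Fact dlim_le_refl : reflexive dlim_le.
Proof.
move=> u; have [a [x ->]] := dlim_rep u.
by apply/dlim_leE; exists a, (lexx a).
Qed.

Fact dlim_le_anti : antisymmetric dlim_le.
Proof.
move=> u v; have [a [x [y [-> ->]]]] := dlim_rep2 u v.
rewrite /dlim_le !dlim_joinE vl_joinC.
by move=> /andP[/eqP-> /eqP].
Qed.

Fact ds_map_le a b c (ab : (a <= b)%O) (bc : (b <= c)%O) (ac : (a <= c)%O)
    (x y : D a) :
  ds_map D ab x <= ds_map D ab y -> ds_map D ac x <= ds_map D ac y.
Proof.
move=> xy; rewrite -!(ds_comp ab bc ac) /=; apply: positive_le => //.
exact: IVL_positive (ds_mapC D bc).
Qed.

Fact dlim_le_trans : transitive dlim_le.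
Proof.
move=> v u w; have [a [x [y [z [-> -> ->]]]]] := dlim_rep3 u v w.
move=> /dlim_leE[b [ab xy]] /dlim_leE[b' [ab' yz]].
have [c [bc b'c]] := directed2 b b'.
apply/dlim_leE; exists c, (le_trans ab bc).
exact: le_trans (ds_map_le bc _ xy) (ds_map_le b'c _ yz).
Qed.

HB.instance Definition _ := Order.Le_isPOrder.Build ring_display dlim
  dlim_le_refl dlim_le_anti dlim_le_trans.

Lemma dlim_in_le a (x y : D a) :
  dlim_in x <= dlim_in y <->
  exists b (ab : (a <= b)%O), ds_map D ab x <= ds_map D ab y.
Proof. exact: dlim_leE. Qed.

Lemma dlim_in_homo a : {homo @dlim_in a : x y / x <= y}.
Proof.
move=> x y xy; apply/dlim_in_le; exists a, (lexx a).
by apply: positive_le => //; exact: IVL_positive (ds_mapC D _).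
Qed.

Fact dlim_leUx u v w :
  (dlim_join u v <= w) = (u <= w) && (v <= w).
Proof.
have [a [x [y [z [-> -> ->]]]]] := dlim_rep3 u v w.
rewrite dlim_joinE.
apply/idP/andP => [xyz|[/dlim_in_le[b [ab xz]] /dlim_in_le[b' [ab' yz]]]].
  by split; apply: le_trans xyz; apply: dlim_in_homo;
    rewrite (vl_leUl, vl_leUr).
have [c [bc b'c]] := directed2 b b'.
apply/dlim_in_le; exists c, (le_trans ab bc); rewrite ds_mapU vl_leUx.
by rewrite (ds_map_le bc _ xz) (ds_map_le b'c _ yz).
Qed.

Fact dlim_lexI u v w :
  (w <= dlim_meet u v) = (w <= u) && (w <= v).
Proof.
have [a [x [y [z [-> -> ->]]]]] := dlim_rep3 u v w.
rewrite dlim_meetE.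
apply/idP/andP => [xyz|[/dlim_in_le[b [ab xz]] /dlim_in_le[b' [ab' yz]]]].
  by split; apply: le_trans xyz _; apply: dlim_in_homo;
    rewrite (vl_leIl, vl_leIr).
have [c [bc b'c]] := directed2 b b'.
apply/dlim_in_le; exists c, (le_trans ab bc); rewrite ds_mapI vl_lexI.
by rewrite (ds_map_le bc _ xz) (ds_map_le b'c _ yz).
Qed.

Fact dlim_leD2r w u v : u <= v -> u + w <= v + w.
Proof.
have [a [x [y [z [-> -> ->]]]]] := dlim_rep3 u v w.
move=> /dlim_in_le[b [ab xy]]; rewrite !dlim_inD; apply/dlim_in_le.
by exists b, ab; rewrite !linearD vl_leDr.
Qed.

Fact dlim_scale_ge0 (k : R) u : 0 <= k -> 0 <= u -> 0 <= k *: u.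
Proof.
move=> k0; have [a [x ->]] := dlim_rep u; rewrite -(dlim_in0 a).
move=> /dlim_in_le[b [ab x0]]; rewrite dlim_inZ; apply/dlim_in_le.
by exists b, ab; move: x0; rewrite linearZ !linear0; apply: vl_scale_ge0.
Qed.

HB.instance Definition _ := isVectorLattice.Build R dlim
  dlim_leUx dlim_lexI dlim_leD2r dlim_scale_ge0.

Fact dlim_in_linear a : linear (@dlim_in a).
Proof. by move=> k x y; rewrite dlim_inZ dlim_inD. Qed.

HB.instance Definition _ a := GRing.isLinear.Build R (D a) dlim *:%R
  (@dlim_in a) (@dlim_in_linear a).

Lemma dlim_in_lattice_hom a : lattice_hom (@dlim_in a).
Proof. by split=> x y; rewrite -(dlim_joinE, dlim_meetE). Qed.

(** An element between 0 and the class of [u] has a representative lying between 0 and the image of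
    [u] at a late enough stage; the transition map into that stage preserves intervals and lifts it
    back to [D a]. *)
Lemma dlim_in_IVL a : @IVL R (D a) dlim (@dlim_in a).
Proof.
split; first exact: dlim_in_lattice_hom.
have in_ge0 := lattice_hom_positive (@dlim_in_lattice_hom a).
apply: interval_preservingP => // u w u0.
have [b [y ->]] := dlim_rep w; have [c [ac bc]] := directed2 a b. rewrite /=.
rewrite -(dlim_in_map bc y) -(dlim_in_map ac u) -(dlim_in0 c).
(* From here [y] lives in [D c]. Its lower bound holds at stage [k] and its upper bound at [k'],
   hence both hold at [m]. *)
move: (ds_map D bc y) => {}y /dlim_in_le[k [ck]]; rewrite linear0 => y0.
move=> /dlim_in_le[k' [ck' yu]]; have [m [km k'm]] := directed2 k k'.
have e_ge0 i j (ij : (i <= j)%O) := IVL_positive (ds_mapC D ij).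
have cm := le_trans ck km; have am := le_trans ac cm.
have y0m : 0 <= ds_map D cm y.
  by rewrite -(ds_comp ck km) /=; exact: e_ge0.
have yum : ds_map D cm y <= ds_map D am u.
  by rewrite -(ds_comp ac cm) /=; apply: ds_map_le yu.
have [x xu xy] := interval_preserving_lift (ds_mapC D am).2 u0 y0m yum.
by exists x; rewrite // -(dlim_in_map cm) -xy dlim_in_map.
Qed.

Definition dlim_cocone : direct_compatible D :=
  @DirectCompatible _ (@IVL R) _ _ D dlim (fun a => @dlim_in a : {linear _ -> _})
    dlim_in_IVL (fun a b ab x => dlim_in_map ab x).

End ConcreteDirectLimit.

(** * Gluing compatible families of linear maps along a cocone *)

Section Factorization.
Variables (R : realType) (d : Order.disp_t) (I : preorderType d).
Variables (dirI : directed I) (D : direct_system (@IVL R) I).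

Definition jointly_surjective (S : direct_compatible D) :=
  forall u : S, exists a (x : D a), u = dc_map S a x.

Definition eventually_injective (S : direct_compatible D) :=
  forall a (x : D a), dc_map S a x = 0 ->
    exists b (ab : (a <= b)%O), ds_map D ab x = 0.

Variable S : direct_compatible D.
Hypothesis Ssurj : jointly_surjective S.

Lemma dc_mapE a b (ab : (a <= b)%O) (x : D a) :
  dc_map S b (ds_map D ab x) = dc_map S a x.
Proof. exact: (dc_comp S ab x). Qed.

Lemma dc_rep2 (u v : S) : exists a (x y : D a), u = dc_map S a x /\ v = dc_map S a y.
Proof.
have [a [x ->]] := Ssurj u; have [b [y ->]] := Ssurj v.
have [c [ac bc]] := directed2 dirI a b.
by exists c, (ds_map D ac x), (ds_map D bc y); rewrite !dc_mapE.
Qed.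

(** Any representative may be replaced by its positive part, because [dc_map S a] commutes with
    [vlpos]. *)
Lemma dc_rep_ge0 (u : S) : 0 <= u -> exists a (x : D a), 0 <= x /\ u = dc_map S a x.
Proof.
have [a [x ->]] := Ssurj u => u0; exists a, (vlpos x); split.
  exact: vlpos_ge0.
by rewrite lattice_hom_vlpos ?vlpos_id //; exact: (dc_mapC S a).1.
Qed.

Hypothesis Sinj : eventually_injective S.

(** The map [h] sends [dc_map S a x] to [g a x]. This is well defined: two representatives of one
    element, moved to a common stage, differ by an element that vanishes later, where [g] is 0. The
    target is only a module, which covers both vector lattices and the scalars. *)
Lemma factorization (V : lmodType R) (g : forall a, D a -> V)
    (g_lin : forall a, linear (g a))
    (g_comp : forall a b (ab : (a <= b)%O), g b \o ds_map D ab =1 g a) :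
  exists2 h : S -> V, linear h & forall a, h \o dc_map S a =1 g a.
Proof.
have gD a (x y : D a) : g a (x - y) = g a x - g a y.
  have := g_lin a (-1) y x; rewrite /= !scaleN1r => e.
  by rewrite [x - y]addrC e addrC.
have g_eq a b (x : D a) (y : D b) : dc_map S a x = dc_map S b y -> g a x = g b y.
  have [c [ac bc]] := directed2 dirI a b.
  rewrite -(dc_mapE ac) -(dc_mapE bc) -(g_comp _ _ ac) -(g_comp _ _ bc) /=.
  move/eqP; rewrite -subr_eq0 -linearB => /eqP /Sinj[k [ck e]].
  apply/eqP; rewrite -subr_eq0 -gD -(g_comp _ _ ck) /= e.
  by rewrite -(subrr (0 : D k)) gD subrr.
have g_ex u : exists w, exists a (x : D a), u = dc_map S a x /\ w = g a x.
  by have [a [x ->]] := Ssurj u; exists (g a x), a, x.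
pose h u := projT1 (cid (g_ex u)).
have hE a (x : D a) : h (dc_map S a x) = g a x.
  by rewrite /h; case: cid => _ /= [b [y [e ->]]]; apply/esym/g_eq.
exists h => // k u v; have [a [x [y [-> ->]]]] := dc_rep2 u v.
by rewrite -linearP !hE g_lin.
Qed.

End Factorization.

(** * Transfer from the concrete limit to an arbitrary direct limit *)

Section LimitRepresentation.
Variables (R : realType) (d : Order.disp_t) (I : preorderType d).
Variables (dirI : directed I) (D : direct_system (@IVL R) I).

Lemma dlim_surjective : jointly_surjective (dlim_cocone dirI D).
Proof. exact: dlim_rep. Qed.

Lemma dlim_injective : eventually_injective (dlim_cocone dirI D).
Proof.
move=> a x; rewrite -(linear0 (dc_map (dlim_cocone dirI D) a)).
move=> /dlim_in_eq[b [ab e]].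
by exists b, ab; rewrite e linear0.
Qed.

(** The glued map inherits its properties from the maps [dc_map S a], since every element of the
    concrete limit, and every positive one with a positive representative, comes from a single
    stage. *)
Lemma dlim_desc (S : direct_compatible D) :
  exists2 q : {linear dlim_cocone dirI D -> S},
    IVL q & forall a, q \o @dlim_in _ _ _ dirI D a =1 dc_map S a.
Proof.
have [h h_lin hE] := factorization dirI dlim_surjective dlim_injective
  (fun a => linearP (dc_map S a)) (dc_comp S).
pose q : {linear dlim_cocone dirI D -> S} := HB.pack_for {linear _ -> _} h
  (GRing.isLinear.Build _ _ _ _ h h_lin).
exists q => //; have qE a x : q (dlim_in dirI x) = dc_map S a x := hE a x.
have q_pos : {morph q : u / vlpos u}.
  move=> u; have [a [x ->]] := dlim_rep u.
  rewrite qE -(lattice_hom_vlpos (dc_mapC S a).1) -qE; congr (q _).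
  by rewrite -(lattice_hom_vlpos (dlim_in_lattice_hom dirI D a)).
have q_hom := lattice_hom_pos q_pos; split=> //.
apply: interval_preservingP => [|u w]; first exact: lattice_hom_positive.
move=> /(dc_rep_ge0 dlim_surjective)[a [x [x0 ->]]] w0; rewrite [q _]qE => wx.
have [y /andP[y0 yx] <-] := interval_preserving_lift (dc_mapC S a).2 x0 w0 wx.
exists (dlim_in dirI y); last exact: qE.
rewrite -(dlim_in0 dirI D a); apply/andP; split; exact: dlim_in_homo.
Qed.

Variables (S : direct_compatible D) (limS : is_direct_limit S).

(* The composite of [S -> dlim -> S] is an endomorphism of the cocone [S], hence
   the identity; so every [u : S] is the image of a class of some [x : D a]. *)
Lemma direct_limit_surjective : jointly_surjective S.
Proof.
have [r [rC rE] _] := limS (dlim_cocone dirI D).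
have [q qC qE] := dlim_desc S.
have [i _ i_uniq] := limS S.
have qr : q \o r =1 idfun.
  move=> u; rewrite (i_uniq (q \o r)) -?(i_uniq idfun) //.
  - exact: IVL_id.
  - exact: IVL_comp.
  - by move=> a x /=; rewrite [r _]rE; exact: qE.
move=> u; have [a [x ru]] := dlim_rep (r u).
by exists a, x; rewrite -qE /= -ru -[LHS]qr.
Qed.

(** The mediating map [r] into the concrete limit sends [dc_map S a x] to the class of [x], so if
    the former is 0, the class is 0 as well. *)
Lemma direct_limit_injective : eventually_injective S.
Proof.
have [r [_ rE] _] := limS (dlim_cocone dirI D).
by move=> a x x0; apply: dlim_injective; rewrite -rE /= x0 linear0.
Qed.

End LimitRepresentation.

(** * The order dual of the limit as an inverse limit *)

Section DualLimit.
Variables (R : realType) (d : Order.disp_t) (I : preorderType d).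
Variables (dirI : directed I) (D : direct_system (@IVL R) I).
Variable S : direct_compatible D.

Let e' a : {linear order_dual S -> order_dual (D a)} :=
  dual_map (IVL_positive (dc_mapC S a)).

Fact dual_cone_mapC a : NVL (e' a).
Proof. exact: dual_map_NVL (dc_mapC S a).2. Qed.

Fact dual_cone_comp a b (ab : (a <= b)%O) :
  is_map (dual_system D) ab \o e' b =1 e' a.
Proof.
by move=> phi; apply: order_dualP => x /=; rewrite -(dc_comp S ab).
Qed.

Definition dual_cone : inverse_compatible (dual_system D) :=
  @InverseCompatible _ (@NVL R) _ _ (dual_system D) (order_dual S) e'
    dual_cone_mapC dual_cone_comp.

Hypothesis Ssurj : jointly_surjective S.

(** Positive elements of [S] come from positive elements of the stages, so the order of functionals
    can be tested stage by stage. *)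
Lemma dual_cone_leP (phi psi : order_dual S) :
  (forall a, e' a phi <= e' a psi) -> phi <= psi.
Proof.
move=> h; apply/od_leP => u /(dc_rep_ge0 Ssurj)[a [x [x0 ->]]].
by have /od_leP/(_ x x0) := h a.
Qed.

Lemma dual_cone_inj (phi psi : order_dual S) :
  (forall a, e' a phi = e' a psi) -> phi = psi.
Proof.
by move=> h; apply/le_anti; rewrite !dual_cone_leP // => a; rewrite h.
Qed.

(** By translation it suffices to bound [h] on [[0, v - u]]. Writing [v - u] as [dc_map S a x] with
    [0 <= x], this interval is the image of [[0, x]], on which [h \o dc_map S a] is bounded. *)
Lemma order_bounded_glue (h : S -> R) : scalar (h : S -> R^o) ->
  (forall a, order_bounded (h \o dc_map S a)) -> order_bounded h.
Proof.
move=> h_lin hB u v; have [uv|nuv] := boolP (u <= v); last first.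
  (* Without [u <= v] the interval is empty, and any bounds will do. *)
  exists 0, 0 => z [w /= + _]; rewrite in_itv /= => /andP[uw wv].
  by rewrite (le_trans uw wv) in nuv.
have hD w : h w = h u + h (w - u).
  by rewrite -[in LHS](subrK u w) -[w - u in LHS]scale1r h_lin mul1r addrC.
move: (uv); rewrite -vl_subr_ge0 => /(dc_rep_ge0 Ssurj)[a [x [x0 vuE]]].
have [l [c lc]] := hB a 0 x.
exists (h u + l), (h u + c) => _ [w /= + <-]; rewrite in_itv /= => /andP[uw wv].
rewrite in_itv /= (hD w) !lerD2l.
have wu0 : 0 <= w - u by rewrite vl_subr_ge0.
have wux : w - u <= dc_map S a x by rewrite -vuE vl_leDr.
have [y yx <-] := interval_preserving_lift (dc_mapC S a).2 x0 wu0 wux.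
have := lc (h (dc_map S a y)); rewrite /= in_itv /=; apply.
by exists y => //=; rewrite in_itv.
Qed.

Hypothesis Sinj : eventually_injective S.

(** Each [phi] in a competing cone [G] gives a compatible family of functionals, glued into one on
    [S]. The restrictions [e' a] jointly detect equality and order, so linearity, the lattice
    property and order continuity of [s], as well as uniqueness, are all checked after composing
    with them. *)
Lemma dual_cone_limit : is_inverse_limit dual_cone.
Proof.
move=> G; have glue (phi : G) :
    exists psi : order_dual S, forall a, e' a psi = ic_map G a phi.
  pose p a : order_dual (D a) := ic_map G a phi.
  have p_comp a b (ab : (a <= b)%O) : p b \o ds_map D ab =1 p a.
    by move=> x; rewrite /p -(ic_comp ab).
  have p_lin a : linear (p a : D a -> R^o) := order_dual_scalar (p a).
  have [h h_lin hE] := factorization (V := R^o) dirI Ssurj Sinj p_lin p_comp.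
  have hP : (h : S -> R^o) \in @order_dual_pred R S.
    apply/order_dual_predP; split=> //; apply: order_bounded_glue => // a.
    have -> : h \o dc_map S a = p a by apply/funext.
    by have /order_dual_predP[] := od_funP (p a).
  by exists (OrderDual hP) => a; apply: order_dualP => x; exact: hE.
pose s0 phi := projT1 (cid (glue phi)).
have s0E phi a : e' a (s0 phi) = ic_map G a phi by rewrite /s0; case: cid.
have s0_lin : linear s0.
  by move=> k phi psi; apply: dual_cone_inj => a; rewrite linearP !s0E linearP.
pose s : {linear G -> order_dual S} := HB.pack_for {linear _ -> _} s0
  (GRing.isLinear.Build _ _ _ _ s0 s0_lin).
have sE phi a : e' a (s phi) = ic_map G a phi := s0E phi a.
exists s; last first.
  by move=> s' _ s'E phi; apply: dual_cone_inj => a; rewrite sE; exact: s'E.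
split; last by move=> a phi; exact: sE.
have s_hom : lattice_hom s.
  apply: lattice_hom_pos => phi; apply: dual_cone_inj => a.
  rewrite (lattice_hom_vlpos (dual_cone_mapC a).1) !sE.
  exact: (lattice_hom_vlpos (ic_mapC G a).1).
split=> //; apply: order_continuousP => // dJ J y dirJ yd.
have [y_decr y_ge0 _] := yd; have s_ge0 := lattice_hom_positive s_hom.
split=> [i j ij|i|z zy].
- exact: positive_le s_ge0 _ _ (y_decr _ _ ij).
- exact: s_ge0.
apply: dual_cone_leP => a; rewrite linear0.
(* The image of [y] under [ic_map G a] decreases to 0 and has [e' a z] as a lower bound, so
   [e' a z <= 0]. *)
have [_ _ p_inf] := order_continuous_decreases_to0 (ic_mapC G a).1
  (ic_mapC G a).2 dirJ yd.
apply: p_inf => i /=; rewrite -sE.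
exact: positive_le (lattice_hom_positive (dual_cone_mapC a).1) _ _ (zy i).
Qed.

End DualLimit.

(** * Uniqueness of inverse limits and the duality theorem *)

(** The mediating maps [T] and [U] between the two limits are mutually inverse: each composite and
    the identity are both mediating maps from a limit to itself, hence equal. *)
Lemma inverse_limit_iso (R : realType) (d : Order.disp_t) (I : preorderType d)
    (G : inverse_system (@NVL R) I) (L M : inverse_compatible G) :
  is_inverse_limit L -> is_inverse_limit M ->
  exists T : {linear M -> L},
    lattice_iso T /\ forall a, ic_map L a \o T =1 ic_map M a.
Proof.
move=> limL limM; have [T [TC TE] _] := limL M; have [U [UC UE] _] := limM L.
exists T; split=> //; split; first exact: TC.1.
exists U => x.
  have [i _ i_uniq] := limM M.
  rewrite -[LHS]/((U \o T) x) (i_uniq (U \o T)) -?(i_uniq idfun) //.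
  - exact: NVL_id.
  - exact: NVL_comp.
  - by move=> a y /=; rewrite [LHS]UE; exact: TE.
have [i _ i_uniq] := limL L.
rewrite -[LHS]/((T \o U) x) (i_uniq (T \o U)) -?(i_uniq idfun) //.
- exact: NVL_id.
- exact: NVL_comp.
- by move=> a y /=; rewrite [LHS]TE; exact: UE.
Qed.

Theorem theorem5p4 (R : realType) (d : Order.disp_t) (I : preorderType d)
    (dirI : directed I) (D : direct_system (@IVL R) I)
    (S : direct_compatible D) (limS : is_direct_limit S) :
  (exists L : inverse_compatible (dual_system D), is_inverse_limit L) /\
  (forall L : inverse_compatible (dual_system D), is_inverse_limit L ->
    exists T : {linear order_dual S -> L},
      lattice_iso T /\
      forall a : I,
        ic_map L a \o T =1 dual_map (IVL_positive (dc_mapC S a))).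
Proof.
have limS' := dual_cone_limit dirI (direct_limit_surjective dirI limS)
  (direct_limit_injective dirI limS).
split=> [|L limL]; first by exists (dual_cone S).
exact: inverse_limit_iso limL limS'.
Qed.
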